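(* Let $d\ge200$, $\alpha=2$ and $p_0=1-\Phi(-2)$, and let $\mathcal{D}$ be the distribution defined in the context. Let $S_\infty(\mathbf{x})=\{\mathbf{x}+\mathbf{r}:\|\mathbf{r}\|_\infty\le 3/\sqrt d\}$, $S_1(\mathbf{x})=\{\mathbf{x}+\mathbf{r}:\|\mathbf{r}\|_1\le3\}$, and $S_{\mathrm{affine}}(\mathbf{x})=\{\mathbf{x}+\mathbf{r}_1+\mathbf{r}_2:\beta\in[0,1],\ \|\mathbf{r}_1\|_\infty\le 3\beta/\sqrt d,\ \|\mathbf{r}_2\|_1\le3(1-\beta)\}$. Then there exists a (necessarily non-linear) classifier $g:\mathbb{R}^{d+1}\to\{-1,+1\}$ with $\mathcal{R}^{\mathrm{max}}_{\mathrm{adv}}(g;S_\infty,S_1)\le 0.35$, while every classifier $f:\mathbb{R}^{d+1}\to\{-1,+1\}$ satisfies $\mathcal{R}_{\mathrm{adv}}(f;S_{\mathrm{affine}})\ge 1/2$.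
   Context: $\Phi$ is the standard normal CDF. The distribution $\mathcal{D}$ over $(\mathbf{x},y)$, $\mathbf{x}=(x_0,\dots,x_d)$: $y$ uniform on $\{-1,+1\}$; given $y$, $x_0=+y$ with probability $p_0$ and $-y$ with probability $1-p_0$; $x_1,\dots,x_d$ i.i.d. $\mathcal{N}(y\eta,1)$ with $\eta=\alpha/\sqrt d$, independent of $x_0$. Adversarial risk: $\mathcal{R}_{\mathrm{adv}}(f;S)=\Pr_{(\mathbf{x},y)\sim\mathcal{D}}[\exists\,\mathbf{x}'\in S(\mathbf{x}): f(\mathbf{x}')\neq y]$; $\mathcal{R}^{\mathrm{max}}_{\mathrm{adv}}(f;S_\infty,S_1)=\mathcal{R}_{\mathrm{adv}}(f;S_\infty\cup S_1)$ with pointwise union of sets. *)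

(* Defs.v *)
From HB Require Import structures.
From mathcomp Require Import all_boot all_order all_algebra.
From mathcomp Require Import all_classical all_reals all_analysis.
Set Implicit Arguments. Unset Strict Implicit. Unset Printing Implicit Defensive.
Import Order.TTheory GRing.Theory Num.Theory.
Import numFieldNormedType.Exports.
Local Open Scope classical_set_scope.
Local Open Scope ring_scope.

Section Defs.
Context {R : realType}.

Definition Phi (x : R) : R := fine (normal_prob 0 1 `]-oo, x]).

(** points of R^{d+1}, written x = (x_0, x_1, ..., x_d) as row vectors;
    coordinate 0 is x_0, coordinate [lift ord0 i] is x_{i+1}. *)
Definition linf_norm (n : nat) (r : 'rV[R]_n) : R := \big[Num.max/0]_(i < n) `|r 0 i|.
Definition l1_norm (n : nat) (r : 'rV[R]_n) : R := \sum_(i < n) `|r 0 i|.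

Definition S_inf (d : nat) (x : 'rV[R]_d.+1) : set 'rV[R]_d.+1 :=
  [set x + r | r in [set r | linf_norm r <= 3 / Num.sqrt (d%:R)]].
Definition S_1 (d : nat) (x : 'rV[R]_d.+1) : set 'rV[R]_d.+1 :=
  [set x + r | r in [set r | l1_norm r <= 3]].
Definition S_affine (d : nat) (x : 'rV[R]_d.+1) : set 'rV[R]_d.+1 :=
  [set x' | exists (beta : R) (r1 r2 : 'rV[R]_d.+1),
     [/\ 0 <= beta <= 1, linf_norm r1 <= 3 * beta / Num.sqrt (d%:R),
         l1_norm r2 <= 3 * (1 - beta) & x' = x + r1 + r2]].

Definition pm1_classifier (n : nat) (f : 'rV[R]_n -> R) : Prop :=
  forall x, f x = 1 \/ f x = -1.

(** (Y, X) defined on the probability space (Omega, P) has law D(d, alpha, p0):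
    Y uniform on {-1,+1}; given Y, X_0 = +Y w.p. p0 and -Y w.p. 1-p0;
    X_1..X_d i.i.d. N(Y*eta, 1), eta = alpha/sqrt d, independent of X_0.
    This is the definition of the joint law on the generating rectangles. *)
Definition has_law_D (d : nat) (alpha p0 : R)
  (dO : measure_display) (Omega : measurableType dO) (P : probability Omega R)
  (Y : Omega -> R) (X : Omega -> 'rV[R]_d.+1) : Prop :=
  [/\ measurable_fun setT Y,
      (forall i, measurable_fun setT (fun w => X w 0 i)) &
      forall (y s0 : R) (B : 'I_d -> set R),
        (y = 1 \/ y = -1) -> (s0 = 1 \/ s0 = -1) -> (forall i, measurable (B i)) ->
        P [set w | [/\ Y w = y, X w 0 ord0 = s0 * y &
                       forall i : 'I_d, B i (X w 0 (lift ord0 i))]]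
        = ((2^-1 * (if s0 == 1 then p0 else 1 - p0))%:E *
           \prod_(i < d) normal_prob (y * (alpha / Num.sqrt (d%:R))) 1 (B i))%E].

Definition adv_event (d : nat) (dO : measure_display) (Omega : measurableType dO)
  (Y : Omega -> R) (X : Omega -> 'rV[R]_d.+1)
  (f : 'rV[R]_d.+1 -> R) (S : 'rV[R]_d.+1 -> set 'rV[R]_d.+1) : set Omega :=
  [set w | exists x', S (X w) x' /\ f x' != Y w].

(** outer probability (coincides with P on measurable sets) *)
Definition outerP (dO : measure_display) (Omega : measurableType dO)
  (P : probability Omega R) (E : set Omega) : \bar R :=
  ereal_inf [set P A | A in [set A | measurable A /\ E `<=` A]].

Definition adv_risk (d : nat) (dO : measure_display) (Omega : measurableType dO)
  (P : probability Omega R) (Y : Omega -> R) (X : Omega -> 'rV[R]_d.+1)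
  (f : 'rV[R]_d.+1 -> R) (S : 'rV[R]_d.+1 -> set 'rV[R]_d.+1) : \bar R :=
  outerP P (adv_event Y X f S).

End Defs.
Arguments S_inf {R d} x _.
Arguments S_1 {R d} x _.
Arguments S_affine {R d} x _.

(* Main.v *)
Require Import Defs.
From HB Require Import structures.
From mathcomp Require Import all_boot all_order all_algebra.
From mathcomp Require Import all_classical all_reals all_analysis.
From mathcomp Require Import measurable_realfun normal_distribution.
From mathcomp Require Import ring lra.
Import Order.TTheory GRing.Theory Num.Theory.
Import numFieldNormedType.Exports.
Local Open Scope classical_set_scope.
Local Open Scope ring_scope.

(** Put [eta = 2 / sqrt d].

    Lower bound.  Under the affine attack the adversary may spend [2 / sqrt d + 2 / d] in
    sup norm on every coordinate and [1 - 2 / sqrt d] in l1 norm on [x_0], which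
    sends [x] to [(0, x_1 - y eta, ..., x_d - y eta)], a vector independent of [y],
    with a margin [2 / d] on every coordinate but the first.  This margin lets the
    adversary round to the corner of a grid cell of side [2 / d].  In each cell it
    fools [f] for one of the two values of [y], and both values are equally likely
    in the cell.  The union of the fooled cells is measurable even when [f] is not.

    Upper bound.  Let [s = x_1 + ... + x_d], which has law [N(2 y sqrt d, d)], and
    classify by comparing [s] with [t], [0] or [- t] according as [x_0 <= -3/4],
    [-3/4 < x_0 <= 3/4] or [3/4 < x_0].  When [x_0 = y], a sup-norm attack moves [s]
    by at most [3 sqrt d] without leaving the region of [x_0], and an l1 attack has to
    pay [7/4] to reach the opposite region, so it moves [s] by at most [5/4].  The
    value [t = (291/200) sqrt d] nearly balances both: either attack succeeds only if
    [y s <= (309/200) sqrt d], that is, [91/200] standard deviations below the mean,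
    which has probability at most [0.3265].  When [x_0 = - y], which has probability
    [Phi(-2) <= 5/144], the attack is counted as successful. *)

(** * Translation of Gaussian measures *)

Section translation.
Context {R : realType}.
Notation mu := (@lebesgue_measure R).

Lemma measurable_shift (a : R) :
  measurable_fun setT ((fun x => x + a) : measurableTypeR R -> measurableTypeR R).
Proof. by apply: measurable_funD. Qed.

(** Uniqueness of Lebesgue measure reduces this to half-open intervals, whose length a translation
    keeps. *)
Lemma lebesgue_measure_shift (a : R) (A : set R) : measurable A ->
  pushforward mu ((fun x => x + a) : _ -> measurableTypeR R) A = mu A.
Proof.
move=> mA; apply/esym/lebesgue_measure_unique => //=.
  exact: measurable_shift.
move=> _ _ [[b c] _ <-].
rewrite /pushforward.
have -> : +%R^~ a @^-1` `]b, c] = `]b - a, c - a]%classic.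
  by apply/seteqP; split => x /=; rewrite !in_itv/= ltrBlDr lerBrDr.
rewrite !lebesgue_measure_itv/= !lte_fin ltrD2r; case: ifP => // _.
by rewrite -!EFinB; congr EFin; ring.
Qed.

Lemma normal_pdf_shift (m s a x : R) : s != 0 ->
  normal_pdf (m + a) s (x + a) = normal_pdf m s x.
Proof.
by move=> s0; rewrite !normal_pdfE//= /normal_fun opprD addrACA subrr addr0.
Qed.

Lemma normal_pdfN (m s x : R) : s != 0 -> normal_pdf (- m) s (- x) = normal_pdf m s x.
Proof.
by move=> s0; rewrite !normal_pdfE//= /normal_fun -opprD sqrrN.
Qed.

Lemma normal_prob_shift (m s a : R) (A : set R) : s != 0 -> measurable A ->
  normal_prob (m + a) s A = normal_prob m s [set x | A (x + a)].
Proof.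
move=> s0 mA; pose f := ((fun x => x + a) : _ -> measurableTypeR R).
rewrite /normal_prob.
transitivity (\int[mu]_(x in f @^-1` A)
    ((fun y => (normal_pdf (m + a) s y)%:E) \o f) x)%E; last first.
  by apply: eq_integral => x _ /=; rewrite normal_pdf_shift.
rewrite -ge0_integral_pushforward//=.
- apply: eq_measure_integral => [|? B mB BA]; first exact: measurable_shift.
  exact/esym/lebesgue_measure_shift.
- exact: measurable_shift.
- apply: measurable_funTS; apply: (@measurableT_comp _ _ _ _ _ _ EFin) => //.
  exact: measurable_normal_pdf.
- by move=> y _; rewrite lee_fin normal_pdf_ge0.
Qed.

Lemma normal_probN (m s : R) (A : set R) : s != 0 -> measurable A ->
  normal_prob (- m) s A = normal_prob m s [set x | A (- x)].
Proof.
move=> s0 mA; rewrite /normal_prob.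
transitivity (\int[mu]_(x in (-%R : _ -> measurableTypeR R) @^-1` A)
    ((fun y => (normal_pdf (- m) s y)%:E) \o -%R) x)%E; last first.
  by apply: eq_integral => x _ /=; rewrite normal_pdfN.
rewrite -ge0_integral_pushforward//=.
- by apply: eq_measure_integral => //= B mB BA; exact/esym/lebesgue_measureN.
- apply/measurable_EFinP/measurable_funTS; exact: measurable_normal_pdf.
- by move=> y _; rewrite lee_fin normal_pdf_ge0.
Qed.

(** The density agrees almost everywhere with the Radon-Nikodym derivative of the Gaussian law. The
    bound on [f] makes it integrable for this probability, as the change of variables requires. *)
Lemma integral_normal_prob (m s : R) (f : R -> \bar R) :
  measurable_fun setT f ->
  (forall x, 0 <= f x <= 1)%E ->
  (\int[normal_prob m s]_x f x = \int[mu]_x (f x * (normal_pdf m s x)%:E))%E.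
Proof.
move=> mf f01.
rewrite -(Radon_Nikodym_change_of_variables (normal_prob_dominates m s))//=; last first.
  apply/integrableP; split => //.
  apply: (@le_lt_trans _ _ (\int[normal_prob m s]_x cst 1 x)%E).
    apply: ge0_le_integral => //=; first exact: measurableT_comp.
    by move=> x _; have /andP[f0 f1] := f01 x; rewrite gee0_abs.
  by rewrite integral_cst//= mul1e probability_setT ltry.
apply: ae_eq_integral => //.
- apply: emeasurable_funM => //; apply: (measurable_int mu).
  apply: Radon_Nikodym_integrable; exact: normal_prob_dominates.
- by apply: emeasurable_funM => //=; apply/measurable_EFinP; exact: measurable_normal_pdf.
- apply: ae_eqe_mul2l => /=.
  rewrite Radon_NikodymE//=; first exact: normal_prob_dominates.
  move=> abmu; case: cid => /= h [h1 h2 h3].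
  apply: integral_ae_eq => //=.
  + by apply/measurable_EFinP; exact: measurable_normal_pdf.
  + by move=> E _ mE; rewrite -h3.
Qed.
End translation.

(** * Convolution of two Gaussian laws *)

Section convolution.
Context {R : realType}.
Notation mu := (@lebesgue_measure R).

(** Completing the square in [x] rewrites the joint density of [(x, z)] as the marginal density of
    [z] times the conditional density of [x] given [z]. The latter integrates to one. *)
Lemma normal_pdf_convolution (a b s t r x z : R) : 0 < s -> 0 < t -> 0 < r ->
  r ^+ 2 = s ^+ 2 + t ^+ 2 ->
  normal_pdf a s x * normal_pdf (x + b) t z =
  normal_pdf (a + b) r z *
  normal_pdf ((t ^+ 2 * a + s ^+ 2 * (z - b)) / r ^+ 2) (s * t / r) x.
Proof.
move=> s0 t0 r0 rE; rewrite !normal_pdfE/= ?gt_eqF ?divr_gt0 ?mulr_gt0//.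
rewrite mulrACA [RHS]mulrACA; congr (_ * _).
  rewrite /normal_peak -!invfM -!sqrtrM ?mulrn_wge0 ?mulr_ge0 ?sqr_ge0 ?pi_ge0 ?ltW//.
  congr (Num.sqrt _)^-1; field; exact: lt0r_neq0.
rewrite /normal_fun -!expRD; congr expR.
have s2 : s != 0 by rewrite gt_eqF.
have t2 : t != 0 by rewrite gt_eqF.
have r2 : s ^+ 2 + t ^+ 2 != 0 by rewrite -rE expf_neq0// gt_eqF.
rewrite expr_div_n exprMn rE; field.
by rewrite s2 t2 r2.
Qed.

Lemma normal_prob_convolution (a b s t r : R) (A : set R) :
  0 < s -> 0 < t -> 0 < r -> r ^+ 2 = s ^+ 2 + t ^+ 2 -> measurable A ->
  (\int[normal_prob a s]_x normal_prob b t [set y : R | A ((x : R) + y)%R])%E =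
  normal_prob (a + b) r A.
Proof.
move=> s0 t0 r0 rE mA.
pose TR := measurableTypeR R.
have shE (x : R) : normal_prob b t [set y | A (x + y)] = normal_prob (x + b) t A.
  rewrite [in RHS]addrC normal_prob_shift ?gt_eqF//; congr (normal_prob _ _ _).
  by apply/funext => y /=; rewrite addrC.
under eq_integral do rewrite shE.
have pdf0 (m v u : R) : 0 <= normal_pdf m v u by exact: normal_pdf_ge0.
pose g (p : TR * TR) : \bar R := (normal_pdf ((p.1 : R) + b) t p.2 * \1_A p.2)%:E.
have mg : measurable_fun setT g.
  apply/measurable_EFinP; apply: measurable_funM; last first.
    by apply: measurableT_comp => //; exact: measurable_indic.
  (* Moving the varying mean into the argument turns the density into one fixed function composed
     with a measurable map, hence jointly measurable. *)
  rewrite (_ : (fun _ => _) =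
      (fun p : TR * TR => normal_pdf 0 t ((p.2 : R) - ((p.1 : R) + b)))).
    apply: (measurableT_comp (measurable_normal_pdf 0 t)) => //.
    by apply: measurable_funB => //; exact: measurable_funD.
  apply/funext => p; rewrite -[in RHS](normal_pdf_shift _ _ ((p.1 : R) + b)) ?gt_eqF//.
  by rewrite add0r subrK.
have g0 p : (0 <= g p)%E by rewrite lee_fin mulr_ge0.
have gE (x : TR) : (\int[mu]_z g (x, z))%E = normal_prob ((x : R) + b) t A.
  rewrite /normal_prob [RHS]integral_mkcond; apply: eq_integral => z _.
  by rewrite patchE /g/= indicE; case: ifPn => _; rewrite ?mulr1 ?mulr0.
rewrite integral_normal_prob; last 2 first.
- rewrite (_ : (fun x : R => _) = (fun x : TR => \int[mu]_z g (x, z))%E).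
    exact: measurable_fun_fubini_tonelli_F.
  by apply/funext => x; rewrite gE.
- by move=> x; rewrite measure_ge0 probability_le1.
pose f (p : TR * TR) : \bar R := ((normal_pdf a s p.1)%:E * g p)%E.
have mf : measurable_fun setT f.
  apply: emeasurable_funM => //; apply/measurable_EFinP.
  by apply: (measurableT_comp (measurable_normal_pdf a s)).
have f0 p : (0 <= f p)%E by rewrite mule_ge0// lee_fin.
transitivity (\int[mu]_x \int[mu]_z f (x, z))%E.
  apply: eq_integral => x _; rewrite -gE muleC /f/= ge0_integralZl//; last first.
    by rewrite lee_fin.
  by apply: measurableT_comp mg _; exact: pair1_measurable.
(* After the exchange the inner integral runs over [x], where only the conditional density remains
   to be integrated. *)
transitivity (\int[mu]_z \int[mu]_x f (x, z))%E.
  exact: fubini_tonelli.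
rewrite /normal_prob [RHS]integral_mkcond; apply: eq_integral => z _.
rewrite patchE; case: ifPn => zA; last first.
  apply: integral0_eq => x _.
  by rewrite /f /g/= indicE (negbTE zA) mulr0 mule0.
transitivity (\int[mu]_x ((normal_pdf (a + b) r z)%:E *
    (normal_pdf ((t ^+ 2 * a + s ^+ 2 * (z - b)) / r ^+ 2) (s * t / r) x)%:E))%E.
  apply: eq_integral => x _; rewrite /f /g/= indicE zA mulr1 -!EFinM.
  by rewrite (normal_pdf_convolution _ _ _ _ r).
rewrite ge0_integralZl//= ?lee_fin//; last 2 first.
- by apply/measurable_EFinP; exact: measurable_normal_pdf.
- by move=> x _; rewrite lee_fin.
by rewrite integral_normal_pdf mule1.
Qed.
End convolution.

(** * Sums of independent Gaussian variables *)

Section sum_of_normals.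
Context {R : realType} {dT : measure_display} {T : measurableType dT}.
Variable P : {measure set T -> \bar R}.
Notation TR := (measurableTypeR R).

(** On [D] the joint law of [(X, Z)] is [c] times a product measure, by uniqueness of product
    measures, so the convolution formula applies. The pair [D], [c] is carried along because the
    coordinates are independent conditionally on the label. *)
Lemma normal_add (D : set T) (X Z : T -> R) (c a b s t r : R) :
  measurable D -> measurable_fun setT X -> measurable_fun setT Z ->
  0 <= c -> 0 < s -> 0 < t -> 0 < r -> r ^+ 2 = s ^+ 2 + t ^+ 2 ->
  (forall A B : set R, measurable A -> measurable B ->
    P (D `&` [set w | A (X w) /\ B (Z w)]) =
    c%:E * (normal_prob a s A * normal_prob b t B))%E ->
  forall A : set R, measurable A ->
    (P (D `&` [set w | A (X w + Z w)%R]) = c%:E * normal_prob (a + b) r A)%E.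
Proof.
move=> mD mX mZ c0 s0 t0 r0 rE PE A mA.
have mXZA : measurable [set w | A (X w + Z w)].
  rewrite -[X in measurable X]setTI.
  by apply: (measurable_funD mX mZ).
(* If [c = 0], then [PE] on the whole space shows that [D] is null. Otherwise dividing by [c]
   normalises the measure restricted to [D]. *)
move: c0; rewrite le_eqVlt => /predU1P[c0|c0].
  rewrite -c0 mul0e; apply/eqP; rewrite -measure_le0.
  have -> : 0%E = P D :> \bar R.
    have := PE setT setT measurableT measurableT.
    by rewrite -c0 mul0e => <-; congr (P _); apply/seteqP; split => [w []//|w].
  by apply: le_measure; rewrite ?inE//; apply: measurableI.
have ci0 : 0 <= c^-1 by rewrite invr_ge0 ltW.
pose XZ w : TR * TR := (X w, Z w).
have mXZ : measurable_fun setT XZ.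
  exact: (@measurable_fun_pair _ _ _ T TR TR X Z mX mZ).
pose Q0 := mscale (NngNum ci0) (pushforward (mrestr P mD) XZ).
have [Q QE] : exists Q : {measure set (TR * TR) -> \bar R}, forall B,
    Q B = (c^-1%:E * P (XZ @^-1` B `&` D))%E by exists (Q0 mXZ).
have prodE (B : set (TR * TR)) : measurable B ->
    (normal_prob a s \x normal_prob b t)%E B = Q B.
  apply: product_measure_unique => // A1 A2 mA1 mA2.
  rewrite QE (_ : _ `&` D = D `&` [set w | A1 (X w) /\ A2 (Z w)]) ?PE//.
    by rewrite muleA -EFinM mulVf ?gt_eqF// mul1e.
  by rewrite setIC.
have mS : measurable [set p : TR * TR | A ((p.1 : R) + p.2)].
  rewrite -[X in measurable X]setTI.
  have mD2 : measurable_fun setT (fun p : TR * TR => (p.1 : R) + p.2).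
    exact: measurable_funD.
  exact: mD2.
have := prodE _ mS; rewrite QE setIC /XZ/= => /(congr1 (fun z => c%:E * z)%E).
rewrite muleA -EFinM divff ?gt_eqF// mul1e => <-; congr *%E.
rewrite -(normal_prob_convolution _ _ _ _ _ _ s0 t0 r0 rE mA).
apply: eq_integral => x _ /=; congr (normal_prob b t _).
by apply/funext => y /=; rewrite /xsection/= inE.
Qed.

Lemma forall_ordS n (Q : 'I_n.+1 -> Prop) :
  (forall i, Q i) <-> Q ord0 /\ forall j, Q (lift ord0 j).
Proof.
split=> [QT|[Q0 QS] i]; first by split.
by case: (unliftP ord0 i) => [j ->|->].
Qed.

Lemma measurable_forall_ord n (X : 'I_n -> T -> R) (B : 'I_n -> set R) :
  (forall i, measurable_fun setT (X i)) -> (forall i, measurable (B i)) ->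
  measurable [set w | forall i, B i (X i w)].
Proof.
move=> mX mB.
rewrite (_ : [set w | _] = \bigcap_(i in [set: 'I_n]) (X i @^-1` B i)).
  apply: fin_bigcap_measurable => [|i _]; first exact: finite_finset.
  by rewrite -[X in measurable X]setTI; exact: mX.
by apply/seteqP; split => w wP i; [move=> _|]; exact: wP.
Qed.

(** Induction on the number of variables: the first two are merged into their sum, which
    [normal_add] shows to be Gaussian and independent of the others. *)
Lemma normal_sum n (D : set T) (X : 'I_n.+1 -> T -> R) (c : R) (m s : 'I_n.+1 -> R) :
  measurable D -> (forall i, measurable_fun setT (X i)) ->
  0 <= c -> (forall i, 0 < s i) ->
  (forall B : 'I_n.+1 -> set R, (forall i, measurable (B i)) ->
    P (D `&` [set w | forall i, B i (X i w)]) =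
    c%:E * \prod_(i < n.+1) normal_prob (m i) (s i) (B i))%E ->
  forall A : set R, measurable A ->
    (P (D `&` [set w | A (\sum_(i < n.+1) X i w)%R]) =
     c%:E * normal_prob (\sum_(i < n.+1) m i)%R
       (Num.sqrt (\sum_(i < n.+1) s i ^+ 2))%R A)%E.
Proof.
move=> mD; elim: n => [|n IH] in X c m s * => mX c0 s0 PE A mA.
  have := PE (fun=> A) (fun=> mA).
  rewrite !big_ord1 sqrtr_sqr gtr0_norm// => <-.
  congr (P (_ `&` _)); apply/seteqP; split => w /=.
    by rewrite big_ord1 => ? i; rewrite (ord1 i).
  by rewrite big_ord1; apply.
pose o1 : 'I_n.+2 := lift ord0 ord0.
pose mrg (F : 'I_n.+2 -> R) (a : R) (i : 'I_n.+1) :=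
  if i == ord0 then a else F (lift ord0 i).
have sumE F : \sum_(i < n.+2) F i =
    \sum_(i < n.+1) mrg F (F ord0 + F o1) i.
  by rewrite !big_ord_recl addrA {1}/mrg eqxx.
pose X' i w := mrg (X ^~ w) (X ord0 w + X o1 w) i.
pose m' := mrg m (m ord0 + m o1).
pose s' := mrg s (Num.sqrt (s ord0 ^+ 2 + s o1 ^+ 2)).
have ss0 : 0 < s ord0 ^+ 2 + s o1 ^+ 2 by rewrite addr_gt0// exprn_gt0.
have -> : \sum_(i < n.+2) s i ^+ 2 = \sum_(i < n.+1) s' i ^+ 2.
  rewrite sumE; apply: eq_bigr => i _; rewrite /s' /mrg; case: ifP => // _.
  by rewrite sqr_sqrtr// ltW.
rewrite sumE.
rewrite (_ : [set w | A (\sum_(i < n.+2) X i w)] =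
  [set w | A (\sum_(i < n.+1) X' i w)]); last first.
  by apply/seteqP; split => w /=; rewrite sumE.
apply: (IH X' c m' s') => //.
- by move=> i; rewrite /X' /mrg; case: (i == ord0) => //; exact: measurable_funD.
- by move=> i; rewrite /s' /mrg; case: ifP => // _; rewrite sqrtr_gt0.
move=> B mB.
(* The constraints on the unmerged variables are absorbed into the event [D], and their
   probabilities [q] into the constant [c]. *)
pose E := [set w | forall j : 'I_n, B (lift ord0 j) (X (lift ord0 (lift ord0 j)) w)].
have mE : measurable E.
  exact: (measurable_forall_ord _ (fun j => X (lift ord0 (lift ord0 j)))
    (fun j => B (lift ord0 j))).
pose N j := normal_prob (m (lift ord0 (lift ord0 j))) (s (lift ord0 (lift ord0 j)))
  (B (lift ord0 j)).
pose q := (\prod_(j < n) fine (N j))%R.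
have qE : q%:E = (\prod_(j < n) N j)%E.
  rewrite /q -prodEFin; apply: eq_bigr => j _; rewrite /N fineK//.
  by apply: fin_num_measure; exact: mB.
have q0 : 0 <= q.
  by apply: prodr_ge0 => i _; exact: fine_ge0.
transitivity (P ((D `&` E) `&` [set w | B ord0 (X ord0 w + X o1 w)])).
  congr (P _); apply/seteqP; split => w /=.
    case=> Dw /forall_ordS[? ?]; split => //.
  case=> -[? ?] ?; split => //. by apply/forall_ordS; split.
rewrite big_ord_recl muleCA -qE -EFinM muleC.
rewrite (normal_add _ _ _ (c * q) (m ord0) (m o1) (s ord0) (s o1)
  (Num.sqrt (s ord0 ^+ 2 + s o1 ^+ 2)))//.
- exact: measurableI.
- exact: mulr_ge0.
- by rewrite sqrtr_gt0.
- by rewrite sqr_sqrtr// ltW.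
move=> A0 A1 mA0 mA1.
(* The family of constraints before merging: [A0] and [A1] on the first two variables, [B] on the
   rest. *)
pose B2 i := if unlift ord0 i is Some j then if j == ord0 then A1 else B j else A0.
have B2E0 : B2 ord0 = A0 by rewrite /B2 unlift_none.
have B2E1 : B2 (lift ord0 ord0) = A1 by rewrite /B2 liftK eqxx.
have B2ES j : B2 (lift ord0 (lift ord0 j)) = B (lift ord0 j) by rewrite /B2 liftK.
have mB2 i : measurable (B2 i).
  by rewrite /B2; case: unliftP => [j _|_]//; case: ifP.
have := PE B2 mB2; rewrite !big_ord_recl B2E0 B2E1.
under eq_bigr do rewrite B2ES.
rewrite -qE => PB2.
rewrite EFinM -muleA [(q%:E * _)%E]muleC -[(_ * q%:E)%E]muleA -PB2.
congr (P _); apply/seteqP; split => w /=.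
  case=> -[Dw Ew] [A0w A1w]; split=> //.
  apply/forall_ordS; rewrite B2E0; split => //.
  apply/forall_ordS; rewrite B2E1; split => // j.
  by rewrite B2ES; exact: Ew.
case=> Dw /forall_ordS; rewrite B2E0 => -[A0w /forall_ordS].
rewrite B2E1 => -[A1w Bw]; split; split=> // j.
by rewrite -B2ES.
Qed.
End sum_of_normals.

(** * Numerical bounds *)

Section numeric.
Context {R : realType}.
Notation mu := (@lebesgue_measure R).

Lemma derive_ge0_ge0 (f df : R -> R) (x : R) :
  (forall y : R, is_derive y 1 f (df y)) -> f 0 = 0 ->
  (forall y, 0 <= y -> 0 <= df y) -> 0 <= x -> 0 <= f x.
Proof.
move=> fdf f0 df0; rewrite le_eqVlt => /predU1P[<-|x0]; first by rewrite f0.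
have [|c xc] := @MVT R f df 0 x x0 (fun y _ => fdf y).
  apply: continuous_subspaceT => y; have [dy _] := fdf y.
  exact/differentiable_continuous/derivable1_diffP.
rewrite f0 !subr0 => ->; rewrite mulr_ge0 ?(ltW x0)// df0//.
by move: xc; rewrite in_itv/= => /andP[/ltW].
Qed.

Lemma sin_le_id (x : R) : 0 <= x -> sin x <= x.
Proof.
move=> x0; rewrite -subr_ge0.
apply: (@derive_ge0_ge0 (fun y => y - sin y) (fun y => 1 - cos y)) x0.
- by rewrite sin0 subrr.
- by move=> y _; rewrite subr_ge0 cos_le1.
Qed.

Lemma cos_ge_quadratic (x : R) : 0 <= x -> 1 - x ^+ 2 / 2 <= cos x.
Proof.
move=> x0; rewrite -subr_ge0.
apply: (@derive_ge0_ge0 (fun y => cos y - (1 - y ^+ 2 / 2)) (fun y => y - sin y)) x0.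
- move=> y; apply: is_derive_eq; rewrite !scaler1 /GRing.scale/=. lra.
- rewrite cos0; lra.
- by move=> y y0; rewrite subr_ge0 sin_le_id.
Qed.

Lemma sin_ge_cubic (x : R) : 0 <= x -> x - x ^+ 3 / 6 <= sin x.
Proof.
move=> x0; rewrite -subr_ge0.
apply: (@derive_ge0_ge0 (fun y => sin y - (y - y ^+ 3 / 6))
  (fun y => cos y - (1 - y ^+ 2 / 2))) x0.
- move=> y; apply: is_derive_eq; rewrite !scaler1 /GRing.scale/=. lra.
- rewrite sin0; lra.
- by move=> y y0; rewrite subr_ge0 cos_ge_quadratic.
Qed.

(** Otherwise [8 / 5] lies below [pi / 2] and has positive cosine. But the cubic bound gives
    [sin (4 / 5)] a square above [1 / 2], so the double angle formula makes that cosine negative. *)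
Lemma pi_le : pi <= 16 / 5 :> R.
Proof.
rewrite leNgt; apply/negP => pi_gt.
have : 0 < cos (8 / 5) :> R by apply: cos_gt0_pihalf; have := @pi_gt0 R; lra.
have := @sin_ge_cubic (4 / 5) ltac:(lra).
have -> : 8 / 5 = (4 / 5) *+ 2 :> R by lra.
rewrite cos_mulr2n; have := cos2Dsin2 (4 / 5 : R); nra.
Qed.

Lemma normal_peak_mul (s : R) : 0 < s -> normal_peak s = (Num.sqrt (pi *+ 2))^-1 / s.
Proof.
move=> s0; rewrite /normal_peak -mulrnAr sqrtrM ?sqr_ge0// sqrtr_sqr gtr0_norm//.
by rewrite invfM mulrC.
Qed.

(** The constant is a rational just below the inverse square root of [2 pi]: the square of [81 / 32]
    exceeds [32 / 5]. *)
Lemma normal_peak_ge (s : R) : 0 < s -> 32 / 81 / s <= normal_peak s.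
Proof.
move=> s0; rewrite normal_peak_mul// ler_pM2r ?invr_gt0//.
have q0 : 0 < Num.sqrt (pi *+ 2) :> R by rewrite sqrtr_gt0 mulrn_wgt0// pi_gt0.
rewrite -[32 / 81]invf_div lef_pV2 ?posrE//.
have -> : 81 / 32 = Num.sqrt ((81 / 32) ^+ 2) :> R by rewrite sqrtr_sqr ger0_norm//; lra.
rewrite ler_sqrt; have := pi_le; lra.
Qed.

Lemma normal_peak_le (s : R) : 0 < s -> normal_peak s <= (2 * s)^-1.
Proof.
move=> s0; rewrite normal_peak_mul// invfM ler_pM2r ?invr_gt0//.
have q0 : 0 < Num.sqrt (pi *+ 2) :> R by rewrite sqrtr_gt0 mulrn_wgt0// pi_gt0.
rewrite lef_pV2 ?posrE//.
have -> : 2 = Num.sqrt (2 ^+ 2) :> R by rewrite sqrtr_sqr ger0_norm.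
rewrite ler_sqrt; last by have := @pi_gt0 R; lra.
have := @pi_ge2 R; lra.
Qed.

Lemma expR_ge_quadratic (x : R) : 0 <= x -> 1 + x + x ^+ 2 / 2 <= expR x.
Proof.
move=> x0; rewrite -subr_ge0.
apply: (@derive_ge0_ge0 (fun y => expR y - (1 + y + y ^+ 2 / 2))
  (fun y => expR y - (1 + y))) x0.
- move=> y; apply: is_derive_eq; rewrite !scaler1 /GRing.scale/=. lra.
- rewrite expR0; lra.
- by move=> y _; rewrite subr_ge0 expR_ge1Dx.
Qed.

(** The quadratic bound at [1 / 4] is squared three times, with rounding down to a simple fraction
    each time. *)
Lemma expR2_ge : 36 / 5 <= expR 2 :> R.
Proof.
have sq (x a b : R) : 0 <= a -> a <= expR x -> b <= a * a -> b <= expR (x *+ 2).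
  move=> a0 ax /le_trans; apply; rewrite mulr2n expRD.
  by apply: ler_pM.
have e1 : 41 / 32 <= expR (1 / 4) :> R.
  by have := @expR_ge_quadratic (1 / 4) ltac:(lra); lra.
have e2 := sq (1 / 4) (41 / 32) (41 / 25) ltac:(lra) e1 ltac:(lra).
have e3 := sq _ (41 / 25) (94 / 35) ltac:(lra) e2 ltac:(lra).
have := sq _ (94 / 35) (36 / 5) ltac:(lra) e3 ltac:(lra).
by congr (_ <= expR _); lra.
Qed.
End numeric.

(** * Gaussian tail bounds with rational constants *)

Section tails.
Context {R : realType}.
Notation mu := (@lebesgue_measure R).

Lemma is_derive_continuous (f df : R -> R) :
  (forall x : R, is_derive x 1 f (df x)) -> continuous f.
Proof.
move=> fdf x; have [dx _] := fdf x.
exact/differentiable_continuous/derivable1_diffP.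
Qed.

(** This is [expR (- u) >= 1 - u] times the bound on the peak; where [1 - u] is negative, positivity
    of the density suffices. *)
Lemma normal_pdf_ge (m s x : R) : 0 < s ->
  32 / 81 / s * (1 - (x - m) ^+ 2 / (2 * s ^+ 2)) <= normal_pdf m s x.
Proof.
move=> s0; rewrite normal_pdfE ?gt_eqF//= /normal_fun.
have uE : - (x - m) ^+ 2 / (s ^+ 2 *+ 2) = - ((x - m) ^+ 2 / (2 * s ^+ 2)).
  by rewrite -(mulr_natl (s ^+ 2)) mulNr.
rewrite uE; set u := (X in 1 - X).
have [u1|u1] := leP 0 (1 - u); last first.
  apply: (@le_trans _ _ 0); last by rewrite mulr_ge0 ?normal_peak_ge0 ?expR_ge0.
  by rewrite mulr_ge0_le0 ?(ltW u1)// divr_ge0 ?(ltW s0)//; lra.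
apply: ler_pM => //; first by rewrite divr_ge0 ?(ltW s0)//; lra.
- exact: normal_peak_ge.
- exact: expR_ge1Dx.
Qed.

(** The polynomial minorant [f] of the density is integrated exactly through its antiderivative
    [F]. *)
Lemma normal_prob_center_ge (m s c : R) : 0 < s -> 0 < c ->
  ((64 / 81 * (c - c ^+ 3 / 6))%R%:E <=
   normal_prob m s `](m - c * s)%R, (m + c * s)%R[)%E.
Proof.
move=> s0 c0.
have cs0 : 0 < c * s by rewrite mulr_gt0.
pose f (x : R) := 32 / 81 / s * (1 - (x - m) ^+ 2 / (2 * s ^+ 2)).
pose F (x : R) := 32 / 81 / s * (x - (x - m) ^+ 3 / (6 * s ^+ 2)).
have sn0 : s != 0 by rewrite gt_eqF.
have dF (x : R) : is_derive x 1 F (f x).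
  apply: is_derive_eq; rewrite /GRing.scale/= /f.
  by field.
have cf : continuous f.
  apply: (@is_derive_continuous _ (fun x => - (32 / 81 / s * ((x - m) / s ^+ 2)))) => x.
  apply: is_derive_eq; rewrite /GRing.scale/= /f.
  by field.
have cF : continuous F by exact: is_derive_continuous dF.
have : (\int[mu]_(x in `[(m - c * s)%R, (m + c * s)%R]) (f x)%:E =
    (F (m + c * s)%R)%:E - (F (m - c * s)%R)%:E)%E.
  apply: continuous_FTC2.
  - lra.
  - exact: continuous_subspaceT.
  - split.
    + by move=> x _; have [] := dF x.
    + exact/cvg_at_right_filter/cF.
    + exact/cvg_at_left_filter/cF.
  - by move=> x _; rewrite derive1E; have [_ ->] := dF x.
have -> : ((F (m + c * s)%R)%:E - (F (m - c * s)%R)%:E)%E =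
    (64 / 81 * (c - c ^+ 3 / 6))%:E.
  by rewrite -EFinB; congr EFin; rewrite /F; field.
move=> <-.
rewrite /normal_prob integral_itv_bndo_bndc//.
rewrite integral_itv_obnd_cbnd//.
apply: le_integral => //=.
- apply: continuous_compact_integrable; first exact: segment_compact.
  exact: continuous_subspaceT.
- apply: (integrableS measurableT) => //; exact: integrable_normal_pdf.
- by move=> x _; rewrite lee_fin normal_pdf_ge.
all: by apply: measurable_funTS; apply/measurable_EFinP; exact: measurable_normal_pdf.
Qed.

Lemma normal_prob_reflect (m s : R) (A : set R) : s != 0 -> measurable A ->
  normal_prob m s A = normal_prob m s [set x | A (m *+ 2 - x)].
Proof.
move=> s0 mA; have mE : m = - m + m *+ 2 by rewrite mulr2n addKr.
rewrite [in LHS]mE normal_prob_shift// normal_probN//.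
  by congr (normal_prob _ _ _); apply/funext => x /=; rewrite addrC.
rewrite -[X in measurable X]setTI; exact: measurable_shift.
Qed.

(** Reflection about [m] gives both tails the same mass, so each is half of what the centre
    leaves. *)
Lemma normal_prob_lower_tail (m s c : R) : 0 < s -> 0 < c ->
  (normal_prob m s `]-oo, (m - c * s)%R] <= (2^-1 - 32 / 81 * (c - c ^+ 3 / 6))%R%:E)%E.
Proof.
move=> s0 c0.
have cs0 : 0 < c * s by rewrite mulr_gt0.
have := normal_prob_center_ge m _ _ s0 c0.
set I := `](m - c * s)%R, (m + c * s)%R[%classic.
set L := `]-oo, (m - c * s)%R]%classic.
pose U : set R := `[(m + c * s)%R, +oo[%classic.
have mL : measurable L by exact: measurable_itv.
have mI : measurable I by exact: measurable_itv.
have mU : measurable U by exact: measurable_itv.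
have UE : normal_prob m s U = normal_prob m s L.
  rewrite normal_prob_reflect ?gt_eqF//; congr (normal_prob _ _ _).
  apply/seteqP; split => x; rewrite /U /L /= !in_itv /= ?andbT => h; move: h;
    by rewrite mulr2n; lra.
have : (normal_prob m s L + normal_prob m s I + normal_prob m s U = 1)%E.
  rewrite -measureU//; last first.
    by rewrite -subset0 => x []; rewrite /L /I/= !in_itv/= => ? /andP[]; lra.
  rewrite -measureU//; last 2 first.
    exact: measurableU.
    rewrite -subset0 => x []; rewrite /L /I /U/= !in_itv/= andbT.
    by case=> [|/andP[]]; lra.
  rewrite -[RHS](probability_setT (normal_prob m s)); congr (normal_prob _ _ _).
  apply/seteqP; split => // x _; rewrite /L /I /U /= !in_itv/= andbT.
  have [|] := leP x (m - c * s); first by left; left.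
  have [|] := ltP x (m + c * s); first by left; right.
  by right.
rewrite UE.
have fL : normal_prob m s L \is a fin_num by apply: fin_num_measure.
have fI : normal_prob m s I \is a fin_num by apply: fin_num_measure.
rewrite -(fineK fL) -(fineK fI) -!EFinD !lee_fin => -[+ +]; lra.
Qed.

Lemma normal_prob_upper_tail (m s c : R) : 0 < s -> 0 < c ->
  (normal_prob m s `[(m + c * s)%R, +oo[ <= (2^-1 - 32 / 81 * (c - c ^+ 3 / 6))%R%:E)%E.
Proof.
move=> s0 c0; rewrite normal_prob_reflect ?gt_eqF//.
rewrite (_ : [set x | `[m + c * s, +oo[%classic (m *+ 2 - x)] =
  `]-oo, (m - c * s)]%classic); first exact: normal_prob_lower_tail.
by apply/seteqP; split => x; rewrite /= !in_itv/= andbT mulr2n; lra.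
Qed.

Lemma Phi_N2_le : Phi (- 2) <= 5 / 144 :> R.
Proof.
rewrite /Phi -lee_fin fineK ?fin_num_measure//.
have -> : normal_prob 0 1 `]-oo, (- 2)] =
    normal_prob 0 1 [set x : R | `]-oo, (- 2)]%classic (- x)].
  by rewrite -normal_probN// oppr0.
rewrite (_ : [set x | `]-oo, (- 2)]%classic (- x)] = `[2, +oo[%classic); last first.
  by apply/seteqP; split => x; rewrite /= !in_itv/= andbT lerN2.
(* The exponent [2 - 2 * x] is the tangent at [2] to the concave function [- x ^+ 2 / 2], and [2^-1]
   bounds the peak. The integral is then [expR (- 2) / 4], at most [5 / 144]. *)
pose f (x : R) := 2^-1 * expR (2 - 2 * x).
pose F (x : R) := - (4^-1 * expR (2 - 2 * x)).
have dF (x : R) : is_derive x 1 F (f x).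
  apply: is_derive_eq; rewrite /GRing.scale/= /f; lra.
have cF : continuous F by exact: is_derive_continuous dF.
have cf : continuous f.
  rewrite (_ : f = fun x => F x * - 2); last by apply/funext => x; rewrite /f /F; lra.
  by move=> x; apply: cvgMl; exact: cF.
apply: (@le_trans _ _ (\int[mu]_(x in `[2%R, +oo[) (f x)%:E)%E).
  apply: ge0_le_integral => //=.
  - by move=> x _; rewrite lee_fin normal_pdf_ge0.
  - apply: measurable_funTS; apply/measurable_EFinP; exact: measurable_normal_pdf.
  - apply: measurable_funTS; apply/measurable_EFinP; exact: continuous_measurable_fun.
  - move=> x _; rewrite lee_fin normal_pdfE ?oner_eq0//= /normal_fun subr0 expr1n /f.
    apply: ler_pM; rewrite ?normal_peak_ge0 ?expR_ge0//.
      by have := @normal_peak_le R 1 ltr01; rewrite mulr1.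
    rewrite ler_expR -subr_ge0.
    have : 0 <= (x - 2) ^+ 2 by exact: sqr_ge0.
    by rewrite expr2; lra.
rewrite (@ge0_continuous_FTC2y _ f F 2 0).
- rewrite sub0e -EFinN lee_fin /F opprK (_ : 2 - 2 * 2 = - 2); last by lra.
  rewrite expRN; have e2 := @expR2_ge R.
  have : (expR 2 : R)^-1 <= (36 / 5)^-1 by rewrite lef_pV2 ?posrE ?expR_gt0//; lra.
  lra.
- by move=> x _; rewrite /f mulr_ge0 ?expR_ge0.
- exact: continuous_subspaceT.
- rewrite -oppr0; apply: cvgN; rewrite -[X in _ --> X](mulr0 4^-1); apply: cvgMr.
  rewrite (_ : (fun x => _) = (fun z => expR (- z)) \o (fun x => 2 * x - 2)); last first.
    by apply/funext => x /=; rewrite opprB.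
  apply: (@cvg_comp _ _ _ _ _ _ (pinfty_nbhs R)); last exact: cvgr_expR.
  rewrite (_ : (fun x => 2 * x - 2) = (fun x => 2 * (x + - 1))); last first.
    by apply/funext => x; ring.
  by apply: gt0_cvgMry => //; exact: cvg_addrr.
- by move=> x _; have [] := dF x.
- exact/cvg_at_right_filter/cF.
- by move=> x _; rewrite derive1E; have [_ ->] := dF x.
Qed.

End tails.

(** * Classifiers depending on the first coordinate and the sum of the others *)

Section norms.
Context {R : realType}.

Lemma linf_normP n (r : 'rV[R]_n) (c : R) : 0 <= c ->
  linf_norm r <= c <-> forall i, `|r 0 i| <= c.
Proof.
move=> c0; rewrite /linf_norm; split=> [/bigmax_leP[_ h] i|h]; first exact: h.
by apply/bigmax_leP; split.
Qed.

Definition tail_sum {n} (x : 'rV[R]_n.+1) : R := \sum_(i < n) x 0 (lift ord0 i).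

Lemma tail_sumD n (x r : 'rV[R]_n.+1) : tail_sum (x + r) = tail_sum x + tail_sum r.
Proof. by rewrite /tail_sum -big_split/=; apply: eq_bigr => i _; rewrite mxE. Qed.

Definition row_cons {n} (a : R) (f : 'I_n -> R) : 'rV[R]_n.+1 :=
  \row_j (if unlift ord0 j is Some i then f i else a).

Lemma row_cons0 n a (f : 'I_n -> R) : row_cons a f 0 ord0 = a.
Proof. by rewrite mxE unlift_none. Qed.

Lemma row_consS n a (f : 'I_n -> R) i : row_cons a f 0 (lift ord0 i) = f i.
Proof. by rewrite mxE liftK. Qed.

(** The sup-norm ball projects onto a rectangle of the plane of first coordinate and tail sum: any
    admissible change of the sum can be spread evenly over the [n.+1] tail coordinates. *)
Lemma S_inf_plane n (x : 'rV[R]_n.+2) (Q : R -> R -> Prop) :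
  let rho := 3 / Num.sqrt n.+1%:R in
  (exists x', S_inf x x' /\ Q (x' 0 ord0) (tail_sum x')) <->
  (exists a b, [/\ `|a - x 0 ord0| <= rho,
     `|b - tail_sum x| <= 3 * Num.sqrt n.+1%:R & Q a b]).
Proof.
move=> rho; have k0 : 0 < Num.sqrt n.+1%:R :> R by rewrite sqrtr_gt0 ltr0n.
have rho0 : 0 <= rho by rewrite divr_ge0// ltW.
have rhoE : 3 * Num.sqrt n.+1%:R = rho *+ n.+1.
  rewrite -[RHS]mulr_natr -[X in rho * X](@sqr_sqrtr R n.+1%:R)// /rho.
  by field; rewrite gt_eqF.
split=> [[_ [[r /= /(linf_normP _ _ _ rho0) rr <-] Qx]]|[a [b [xa sb Qab]]]].
  exists ((x + r) 0 ord0), (tail_sum (x + r)); split => //.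
    by rewrite mxE addrAC subrr add0r.
  rewrite tail_sumD addrAC subrr add0r rhoE (le_trans (ler_norm_sum _ _ _))//.
  rewrite (le_trans (ler_sum _ (fun i _ => rr (lift ord0 i))))//.
  by rewrite sumr_const card_ord.
pose r : 'rV[R]_n.+2 := row_cons (a - x 0 ord0) (fun=> (b - tail_sum x) / n.+1%:R).
have r0 : (x + r) 0 ord0 = a by rewrite mxE row_cons0 addrC subrK.
have rs : tail_sum (x + r) = b.
  rewrite tail_sumD /tail_sum; under [X in _ + X]eq_bigr do rewrite row_consS.
  rewrite sumr_const card_ord -(mulr_natr (_ / _)) divfK ?pnatr_eq0//.
  by rewrite addrC subrK.
exists (x + r); split; last by rewrite r0 rs.
exists r => //=; apply/(linf_normP _ _ _ rho0) => i.
case: (unliftP ord0 i) => [j ->|->]; last by rewrite row_cons0.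
rewrite row_consS normrM normfV (@ger0_norm _ n.+1%:R)// ler_pdivrMr ?ltr0n//.
by rewrite mulr_natr -rhoE.
Qed.

(** The projection is the l1 ball of the plane, since the whole change of the sum can be put on a
    single tail coordinate. *)
Lemma S_1_plane n (x : 'rV[R]_n.+2) (Q : R -> R -> Prop) :
  (exists x', S_1 x x' /\ Q (x' 0 ord0) (tail_sum x')) <->
  (exists a b, `|a - x 0 ord0| + `|b - tail_sum x| <= 3 /\ Q a b).
Proof.
split=> [[_ [[r /= r3 <-] Qx]]|[a [b [ab3 Qab]]]].
  exists ((x + r) 0 ord0), (tail_sum (x + r)); split => //.
  rewrite mxE addrAC subrr add0r tail_sumD addrAC subrr add0r.
  apply: le_trans r3; rewrite /l1_norm big_ord_recl lerD2l.
  exact: ler_norm_sum.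
pose r : 'rV[R]_n.+2 := row_cons (a - x 0 ord0)
  (fun i => if i == ord0 then b - tail_sum x else 0).
have r0 : (x + r) 0 ord0 = a by rewrite mxE row_cons0 addrC subrK.
have rs : tail_sum (x + r) = b.
  rewrite tail_sumD /tail_sum; under [X in _ + X]eq_bigr do rewrite row_consS.
  by rewrite -big_mkcond/= big_pred1_eq addrC subrK.
exists (x + r); split; last by rewrite r0 rs.
exists r => //=; rewrite /l1_norm big_ord_recl row_cons0.
under eq_bigr do rewrite row_consS.
rewrite (bigD1 ord0)//= big1 ?addr0// => i /negPf ->.
by rewrite normr0.
Qed.

End norms.

(** * Attacks on the threshold rule in the plane *)

Section threshold.
Context {R : realType}.
Implicit Types a b x s t rho K : R.

Definition threshold t a : R :=
  if a <= - (3 / 4) then t else if a <= 3 / 4 then 0 else - t.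

Lemma threshold_noninc t a b : 0 <= t -> a <= b -> threshold t b <= threshold t a.
Proof.
move=> t0 ab; rewrite /threshold.
case: (leP b _) => h1; case: (leP a _) => h2; try lra;
  case: (leP b _) => h3; try lra; case: (leP a _) => h4; lra.
Qed.

(** As the threshold is nonincreasing, one corner of the rectangle decides whether an attack exists.
    The boolean form replaces an existential and makes measurability immediate. *)
Definition inf_below t rho K x s : bool := s - K <= threshold t (x - rho).
Definition inf_above t rho K x s : bool := threshold t (x + rho) < s + K.

Lemma inf_belowP t rho K x s : 0 <= t -> 0 <= rho -> 0 <= K ->
  (exists a b, [/\ `|a - x| <= rho, `|b - s| <= K & b <= threshold t a]) <->
  inf_below t rho K x s.
Proof.
move=> t0 rho0 K0; split => [[a [b [+ + bt]]]|h].
  rewrite !ler_norml => /andP[xa _] /andP[sb _].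
  have /(threshold_noninc _ _ _ t0) : x - rho <= a by lra.
  rewrite /inf_below; lra.
exists (x - rho), (s - K); split => //.
  by rewrite addrAC subrr add0r normrN ger0_norm.
by rewrite addrAC subrr add0r normrN ger0_norm.
Qed.

Lemma inf_aboveP t rho K x s : 0 <= t -> 0 <= rho -> 0 <= K ->
  (exists a b, [/\ `|a - x| <= rho, `|b - s| <= K & threshold t a < b]) <->
  inf_above t rho K x s.
Proof.
move=> t0 rho0 K0; split => [[a [b [+ + bt]]]|h].
  rewrite !ler_norml => /andP[_ xa] /andP[_ sb].
  have /(threshold_noninc _ _ _ t0) : a <= x + rho by lra.
  rewrite /inf_above; lra.
exists (x + rho), (s + K); split => //.
  by rewrite addrAC subrr add0r ger0_norm.
by rewrite addrAC subrr add0r ger0_norm.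
Qed.

(* One disjunct per region of [threshold]; the constants are [3 + 3/4] and [3 - 3/4]. *)
Definition one_below t x s : bool :=
  [|| s - 3 <= - t,
      [&& x <= 15 / 4, s <= 3 & s + x <= 15 / 4] |
      [&& x <= 9 / 4, s <= 3 + t & s + x <= t + 9 / 4]].
Definition one_above t x s : bool :=
  [|| t < s + 3,
      [&& - (15 / 4) < x, 0 < s + 3 & - (15 / 4) < s + x] |
      [&& - (9 / 4) < x, - t < s + 3 & - (t + 9 / 4) < s + x]].

(** For each region, the best attack moves the first coordinate just to its boundary, if it has to,
    and spends the rest of the budget on the sum. *)
Lemma one_belowP t x s : 0 <= t ->
  (exists a b, `|a - x| + `|b - s| <= 3 /\ b <= threshold t a) <-> one_below t x s.
Proof.
move=> t0; split => [[a [b [ab3]]]|].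
  have := ler_norm (x - a); rewrite distrC => xa.
  have := ler_norm (s - b); rewrite distrC => sb.
  have := normr_ge0 (a - x); have := normr_ge0 (b - s) => sb0 xa0.
  rewrite /threshold; case: (leP a (- (3 / 4))) => [ha hb|ha].
    by apply/or3P; apply: Or33; apply/and3P; split; lra.
  case: (leP a (3 / 4)) => [ha2 hb|ha2 hb].
    by apply/or3P; apply: Or32; apply/and3P; split; lra.
  by apply/or3P; apply: Or31; lra.
case/or3P => [h|/and3P[h1 h2 h3]|/and3P[h1 h2 h3]].
- exists x, (s - 3); split; last first.
    by rewrite /threshold; case: ifP => _; [|case: ifP => _]; lra.
  by rewrite subrr normr0 add0r addrAC subrr add0r normrN ger0_norm.
- have [x34|x34] := leP x (3 / 4).
    exists x, (s - 3); split; last by rewrite /threshold x34; case: ifP => _; lra.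
    by rewrite subrr normr0 add0r addrAC subrr add0r normrN ger0_norm.
  (* Reaching the middle region costs [x - 3 / 4], which leaves [15 / 4 - x] for the sum. *)
  exists (3 / 4), (s - (15 / 4 - x)); split; last first.
    by rewrite /threshold lexx; case: ifP => _; lra.
  by rewrite ltr0_norm ?ler0_norm; lra.
- have [x34|x34] := leP x (- (3 / 4)).
    exists x, (s - 3); split; last by rewrite /threshold x34; lra.
    by rewrite subrr normr0 add0r addrAC subrr add0r normrN ger0_norm.
  exists (- (3 / 4)), (s - (9 / 4 - x)); split; last first.
    by rewrite /threshold lexx; lra.
  by rewrite ltr0_norm ?ler0_norm; lra.
Qed.

Lemma one_aboveP t x s : 0 <= t ->
  (exists a b, `|a - x| + `|b - s| <= 3 /\ threshold t a < b) <-> one_above t x s.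
Proof.
move=> t0; split => [[a [b [ab3]]]|].
  have xa := ler_norm (a - x).
  have sb := ler_norm (b - s).
  have := normr_ge0 (a - x); have := normr_ge0 (b - s) => sb0 xa0.
  rewrite /threshold; case: (leP a (- (3 / 4))) => [ha hb|ha].
    by apply/or3P; apply: Or31; lra.
  case: (leP a (3 / 4)) => [ha2 hb|ha2 hb].
    by apply/or3P; apply: Or32; apply/and3P; split; lra.
  by apply/or3P; apply: Or33; apply/and3P; split; lra.
(* the infimum of the admissible costs is not attained: move to the midpoint *)
case/or3P => [h|/and3P[h1 h2 h3]|/and3P[h1 h2 h3]].
- exists x, (s + 3); split; last first.
    by rewrite /threshold; case: ifP => _; [|case: ifP => _]; lra.
  by rewrite subrr normr0 add0r addrAC subrr add0r ger0_norm.
- have [x34|x34] := ltP (- (3 / 4)) x.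
    exists x, (s + 3); split; last by rewrite /threshold leNgt x34/=; case: ifP => _; lra.
    by rewrite subrr normr0 add0r addrAC subrr add0r ger0_norm.
  pose u := (- (3 / 4) - x + Num.min 3 (s + 3)) / 2.
  have [u1 u2 u3] : [/\ - (3 / 4) - x < u, u <= 3 & u < s + 3].
    by rewrite /u; case: (leP 3 (s + 3)) => m; split; lra.
  exists (x + u), (s + (3 - u)); split; last first.
    by rewrite /threshold leNgt (_ : - (3 / 4) < x + u)/=; [case: ifP => _|]; lra.
  by rewrite !(addrAC _ _ (- _)) !subrr !add0r !ger0_norm; lra.
- have [x34|x34] := ltP (3 / 4) x.
    exists x, (s + 3); split; last first.
      by rewrite /threshold !leNgt x34/= (_ : - (3 / 4) < x)/=; lra.
    by rewrite subrr normr0 add0r addrAC subrr add0r ger0_norm.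
  pose u := (3 / 4 - x + Num.min 3 (s + 3 + t)) / 2.
  have [u1 u2 u3] : [/\ 3 / 4 - x < u, u <= 3 & u < s + 3 + t].
    by rewrite /u; case: (leP 3 (s + 3 + t)) => m; split; lra.
  exists (x + u), (s + (3 - u)); split; last first.
    have [g1 g2] : - (3 / 4) < x + u /\ 3 / 4 < x + u by split; lra.
    by rewrite /threshold leNgt g1/= leNgt g2/=; lra.
  by rewrite !(addrAC _ _ (- _)) !subrr !add0r !ger0_norm; lra.
Qed.
End threshold.

(** * The affine attack *)

Section lower_bound.
Context {R : realType}.

Lemma S_affine_kill_sign n (x z : 'rV[R]_n.+1) : (4 <= n)%N ->
  x 0 ord0 = 1 \/ x 0 ord0 = - 1 -> z 0 ord0 = 0 ->
  (forall i, `|z 0 (lift ord0 i) - x 0 (lift ord0 i)| <= 2 / Num.sqrt n%:R + 2 / n%:R) ->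
  S_affine x z.
Proof.
move=> n4 x1 z0 zx.
set k := Num.sqrt n%:R in zx *.
have k2 : 2 <= k.
  have -> : 2 = Num.sqrt (4%:R) :> R.
    by rewrite (_ : 4%:R = 2 ^+ 2) ?sqrtr_sqr ?ger0_norm//; lra.
  by rewrite ler_sqrt// ler_nat.
have k0 : 0 < k by lra.
have nE : n%:R = k ^+ 2 by rewrite /k sqr_sqrtr.
have xn : `|x 0 ord0| = 1 by case: x1 => ->; rewrite ?normrN normr1.
(* The hypothesis [4 <= n] enters here: it gives [beta <= 1] and a nonnegative l1 share
   [1 - 2 / k]. *)
have ik : 2 / k <= 1 by rewrite ler_pdivrMr// mul1r.
have ik0 : 0 < 2 / k by rewrite divr_gt0.
(* Chosen so that the sup-norm radius is [2 / k + 2 / n]. The l1 radius is then [1 - 2 / k], exactly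
   what is missing to bring the first coordinate to [0] after a sup-norm move of [2 / k]. *)
pose beta : R := (2 + 2 / k) / 3.
pose r1 : 'rV[R]_n.+1 := row_cons (- (2 / k) * x 0 ord0)
  (fun i => z 0 (lift ord0 i) - x 0 (lift ord0 i)).
pose r2 : 'rV[R]_n.+1 := row_cons (- (1 - 2 / k) * x 0 ord0) (fun=> 0).
have bE : 3 * beta / k = 2 / k + 2 / n%:R.
  by rewrite nE /beta; field; rewrite gt_eqF.
have in0 : 0 <= 2 / n%:R :> R by rewrite divr_ge0.
exists beta, r1, r2; split.
- by rewrite /beta; apply/andP; split; lra.
- apply/linf_normP; first by rewrite bE; lra.
  move=> i; rewrite bE; case: (unliftP ord0 i) => [j ->|->].
    by rewrite row_consS.
  by rewrite row_cons0 normrM xn mulr1 normrN ger0_norm; lra.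
- rewrite /l1_norm big_ord_recl row_cons0 big1 => [|i _].
    by rewrite addr0 normrM xn mulr1 normrN ger0_norm /beta; lra.
  by rewrite row_consS normr0.
- apply/rowP => i; rewrite !mxE; case: unliftP => [j ->|->].
    by rewrite addr0 addrC subrK.
  by rewrite z0; lra.
Qed.

End lower_bound.

(** * Signed events, grid cells and their probabilities *)

Section law.
Context {R : realType} {n : nat} {dO : measure_display} {T : measurableType dO}.
Variables (alpha p0 : R) (P : probability T R) (Y : T -> R) (X : T -> 'rV[R]_n.+1).
Hypothesis law : has_law_D alpha p0 P Y X.

Definition signed_event (y s : R) : set T := [set w | Y w = y /\ X w 0 ord0 = s * y].

Definition sign_prob (s : R) : R := 2^-1 * (if s == 1 then p0 else 1 - p0).

Lemma measurable_signed_event y s : measurable (signed_event y s).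
Proof.
have [mY mX _] := law.
apply: (@measurableI _ _ (Y @^-1` [set y]) ((fun w => X w 0 ord0) @^-1` [set s * y])).
- by rewrite -[X in measurable X]setTI; apply: mY.
- by rewrite -[X in measurable X]setTI; apply: (mX ord0).
Qed.

Lemma signed_event_law (y s : R) (B : 'I_n -> set R) :
  y = 1 \/ y = -1 -> s = 1 \/ s = -1 -> (forall i, measurable (B i)) ->
  (P (signed_event y s `&` [set w | forall i, B i (X w 0%R (lift ord0 i))]) =
   (sign_prob s)%:E *
   \prod_(i < n) normal_prob (y * (alpha / Num.sqrt n%:R))%R 1%R (B i))%E.
Proof.
move=> y1 s1 mB; have [_ _ <-//] := law.
by congr (P _); apply/seteqP; split => w /= [] => [[]|]; split.
Qed.

Lemma signed_event_prob (y s : R) : y = 1 \/ y = -1 -> s = 1 \/ s = -1 ->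
  P (signed_event y s) = (sign_prob s)%:E.
Proof.
move=> y1 s1.
have := signed_event_law y s (fun=> setT) y1 s1 (fun=> measurableT).
rewrite big1 ?mule1 => [<-|i _]; last exact: probability_setT.
by congr (P _); apply/seteqP; split => w /=; [split|case].
Qed.

Lemma signed_event_disj y s s' : y = 1 \/ y = -1 -> s != s' ->
  signed_event y s `&` signed_event y s' = set0.
Proof.
move=> y1 ss'; rewrite -subset0 => w [[_ /= e] [_ /= e']]; move/negP: ss'; apply.
apply/eqP; apply: (@mulIf _ y); last by rewrite -e.
by case: y1 => ->; rewrite ?oppr_eq0 oner_eq0.
Qed.

Variable eta delta : R.
Hypothesis etaE : eta = alpha / Num.sqrt n%:R.
Hypothesis delta0 : 0 < delta.

(** The grid is shifted by the mean [y * eta], so that the mass of a cell under label [y] does not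
    depend on [y]. Half-open cells tile the line. *)
Definition cell (y : R) (k : int) : set R :=
  `[k%:~R * delta + y * eta, (k + 1)%:~R * delta + y * eta[%classic.

Lemma cell_uniq y k k' x : cell y k x -> cell y k' x -> k = k'.
Proof.
suff fl j : cell y j x -> Num.floor ((x - y * eta) / delta) = j.
  by move=> /fl <- /fl <-.
rewrite /cell/= in_itv/= => /andP[x1 x2]; apply: Num.Theory.floor_def.
rewrite ler_pdivlMr// ltr_pdivrMr//; apply/andP; split; lra.
Qed.

Lemma cell_cover y x : cell y (Num.floor ((x - y * eta) / delta)) x.
Proof.
have := Num.Theory.real_floor_itv (num_real ((x - y * eta) / delta)).
rewrite ler_pdivlMr// ltr_pdivrMr// /cell/= in_itv/= => /andP[? ?].
by apply/andP; split; lra.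
Qed.

Lemma normal_prob_cell y k :
  normal_prob (y * eta) 1 (cell y k) = normal_prob 0 1 (cell 0 k).
Proof.
rewrite -[X in normal_prob X 1 (cell y k)]add0r normal_prob_shift ?oner_eq0//; last first.
  exact: measurable_itv.
congr (normal_prob _ _ _); apply/seteqP.
by split => x; rewrite /cell/= !in_itv/= mul0r => /andP[? ?]; apply/andP; split; lra.
Qed.

Notation idx := ({ffun 'I_n -> int} * bool)%type.

Definition block (y : R) (k : idx) : set T :=
  signed_event y (if k.2 then 1 else -1) `&`
  [set w | forall i, cell y (k.1 i) (X w 0 (lift ord0 i))].

Lemma sign_choice (b : bool) :
  (if b then 1 else -1) = 1 :> R \/ (if b then 1 else -1) = -1 :> R.
Proof. by case: b; [left|right]. Qed.

Lemma measurable_block y k : measurable (block y k).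
Proof.
have [_ mX _] := law.
apply: measurableI; first exact: measurable_signed_event.
apply: (@measurable_forall_ord R _ T n (fun i w => X w 0 (lift ord0 i))
  (fun i => cell y (k.1 i))) => // i.
exact: measurable_itv.
Qed.

(** The shift of the grid cancels the shift of the mean, and the probability that the first
    coordinate agrees with the label is the same for both labels. *)
Lemma block_prob y k : y = 1 \/ y = -1 -> P (block y k) = P (block 1 k).
Proof.
have blockE z : z = 1 \/ z = -1 -> P (block z k) =
    ((sign_prob (if k.2 then 1 else -1))%:E *
     \prod_(i < n) normal_prob 0 1 (cell 0 (k.1 i)))%E.
  move=> z1; rewrite /block.
  rewrite (signed_event_law z _ (fun i => cell z (k.1 i)))//; last 2 first.
  - exact: sign_choice.
  - by move=> i; exact: measurable_itv.
  rewrite -etaE; congr *%E; apply: eq_bigr => i _.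
  by rewrite normal_prob_cell.
by move=> y1; rewrite !blockE//; left.
Qed.

(** One label [c k] is selected for each block. Enumeration by natural numbers allows countable
    additivity, and numbers that code no index give the empty set. *)
Definition blocks (c : idx -> R) (m : nat) : set T :=
  if pickle_inv m is Some k then block (c k) k else set0.

Lemma measurable_blocks c m : measurable (blocks c m).
Proof. by rewrite /blocks; case: pickle_inv => // k; exact: measurable_block. Qed.

(** A common point determines the label, then the cells for that label, then the sign, hence the
    index. *)
Lemma trivIset_blocks c : (forall k, c k = 1 \/ c k = -1) -> trivIset setT (blocks c).
Proof.
move=> c1; apply/trivIsetP => a b _ _; apply: contra_neqP => /eqP/set0P[w []].
rewrite /blocks; case Ea : (pickle_inv a) => [k|]//; case Eb : (pickle_inv b) => [k'|]//.
move=> [[/= Yk Xk] Ck] [[/= Yk' Xk'] Ck'].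
have cc : c k = c k' by rewrite -Yk.
suff kk : k = k'.
  have := @pickle_invK idx a; have := @pickle_invK idx b.
  by rewrite Ea Eb/= kk => -> ->.
case: k k' c1 cc Ck Ck' Xk Xk' {Ea Eb Yk Yk'} => [k s] [k' s'] c1/= cc Ck Ck' Xk Xk'.
congr pair.
- apply/ffunP => i; apply: (@cell_uniq (c (k, s)) _ _ _ (Ck i)); rewrite cc; exact: Ck'.
- move: Xk; rewrite Xk' cc => /mulIf.
  have cn0 : c (k', s') != 0 by case: (c1 (k', s')) => ->; rewrite ?oppr_eq0 oner_eq0.
  move/(_ cn0); case: s {Ck cc}; case: s' {Ck' Xk' cn0} => //; lra.
Qed.

(** Switching every selected label to [1] changes no term of the series, and the blocks of label [1]
    fill the two signed events of that label, of total mass one half. *)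
Lemma blocks_prob c : (forall k, c k = 1 \/ c k = -1) ->
  P (\bigcup_m blocks c m) = (2^-1)%:E.
Proof.
move=> c1.
have cst1 : forall k : idx, (fun=> 1 : R) k = 1 \/ (fun=> 1 : R) k = -1 by left.
transitivity (P (\bigcup_m blocks (fun=> 1) m)).
  rewrite !measure_bigcup//.
  - apply: eq_eseriesr => m _; rewrite /blocks; case: pickle_inv => // k.
    exact: block_prob.
  - by move=> m _; exact: measurable_blocks.
  - exact: trivIset_blocks.
  - by move=> m _; exact: measurable_blocks.
  - exact: trivIset_blocks.
rewrite (_ : \bigcup_m _ = signed_event 1 1 `|` signed_event 1 (-1)).
  rewrite measureU; try exact: measurable_signed_event; last first.
    by apply: signed_event_disj; [left|rewrite gt_eqF//; lra].
  transitivity ((sign_prob 1)%:E + (sign_prob (-1))%:E)%E.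
    by congr (_ + _)%E; apply: signed_event_prob; by [left|right].
  rewrite /sign_prob eqxx ifF -?EFinD; last by rewrite lt_eqF//; lra.
  by rewrite -mulrDr [p0 + _]addrC subrK mulr1.
apply/seteqP; split => w.
  case=> m _; rewrite /blocks; case: pickle_inv => // -[k [|]] [? _]; by [left|right].
pose k := [ffun i => Num.floor ((X w 0 (lift ord0 i) - 1 * eta) / delta)].
have kw i : cell 1 (k i) (X w 0 (lift ord0 i)) by rewrite ffunE; exact: cell_cover.
case=> [?|?].
  by exists (pickle (k, true)) => //; rewrite /blocks pickleK_inv; split.
by exists (pickle (k, false)) => //; rewrite /blocks pickleK_inv; split.
Qed.

End law.

(** * Every classifier loses one half under the affine attack *)

Section lower_bound.
Context {R : realType}.

Lemma adv_risk_S_affine_ge n (p0 : R) (dO : measure_display) (T : measurableType dO)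
  (P : probability T R) (Y : T -> R) (X : T -> 'rV[R]_n.+1) (f : 'rV[R]_n.+1 -> R) :
  (4 <= n)%N -> has_law_D 2 p0 P Y X -> pm1_classifier f ->
  ((2^-1)%:E <= adv_risk P Y X f S_affine)%E.
Proof.
move=> n4 law f1.
have n0 : 0 < n%:R :> R by rewrite ltr0n (leq_trans _ n4).
pose eta : R := 2 / Num.sqrt n%:R.
pose delta : R := 2 / n%:R.
have delta0 : 0 < delta by rewrite divr_gt0.
(* The lower corner of the unshifted cell, with first coordinate [0]. Each tail coordinate of a
   point in the cell of either label is within [eta + delta] of it. *)
pose center (k : {ffun 'I_n -> int}) : 'rV[R]_n.+1 :=
  row_cons 0 (fun i => (k i)%:~R * delta).
(* The label on which [f] errs at the corner. *)
pose c (k : {ffun 'I_n -> int} * bool) : R := - f (center k.1).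
have c1 k : c k = 1 \/ c k = -1.
  by rewrite /c; case: (f1 (center k.1)) => ->; rewrite ?opprK; [right|left].
(* Every measurable cover of the adversarial event contains the union of the selected blocks. *)
apply: le_ereal_inf_tmp => _ [A [mA EA] <-].
rewrite -(@blocks_prob _ _ _ _ _ _ _ _ _ law eta delta erefl delta0 c c1).
apply: le_measure; rewrite ?inE//.
  apply: bigcupT_measurable => m; exact: (measurable_blocks _ _ _ _ _ law).
apply: subset_trans EA => w [m _]; rewrite /blocks; case: pickle_inv => // -[k s].
move=> [[/= Yw Xw] kw]; exists (center k); split; last first.
  rewrite Yw /c/=; case: (f1 (center k)) => ->; first by rewrite gt_eqF//; lra.
  by rewrite opprK lt_eqF//; lra.
have eta0 : 0 < eta by rewrite divr_gt0// sqrtr_gt0.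
have cn : `|c (k, s)| = 1 by case: (c1 (k, s)) => ->; rewrite ?normrN normr1.
apply: S_affine_kill_sign => //.
- rewrite Xw; case: (c1 (k, s)) => ->; case: s {Xw Yw cn kw};
    rewrite ?mul1r ?mulN1r ?opprK; by [left|right].
- by rewrite row_cons0.
move=> i; rewrite row_consS -/eta -/delta.
have := kw i; rewrite /cell/= in_itv/= intrD => /andP[x1 x2].
rewrite ler_norml; move: (c1 (k, s)) x1 x2 => [->|->] x1 x2; apply/andP; split; lra.
Qed.
End lower_bound.

(** * The union of both attacks *)

Section upper_bound.
Context {R : realType} {n : nat}.
Notation k := (Num.sqrt n.+1%:R : R).

Definition step_classifier (t : R) (x : 'rV[R]_n.+2) : R :=
  if threshold t (x 0 ord0) < tail_sum x then 1 else -1.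

Lemma step_classifier_pm1 t : pm1_classifier (step_classifier t).
Proof. by move=> x; rewrite /step_classifier; case: ifP; [left|right]. Qed.

Definition attack_below t x s := inf_below t (3 / k) (3 * k) x s || one_below t x s.
Definition attack_above t x s := inf_above t (3 / k) (3 * k) x s || one_above t x s.

Lemma attack_plane (x : 'rV[R]_n.+2) (Q : R -> R -> Prop) :
  (exists x', (S_inf x `|` S_1 x) x' /\ Q (x' 0 ord0) (tail_sum x')) <->
  (exists a b, [/\ `|a - x 0 ord0| <= 3 / k, `|b - tail_sum x| <= 3 * k & Q a b]) \/
  (exists a b, `|a - x 0 ord0| + `|b - tail_sum x| <= 3 /\ Q a b).
Proof.
have hinf := S_inf_plane n x Q; have hone := S_1_plane n x Q.
split=> [[x' [[Sx|Sx] Qx]]|[/hinf[x' [Sx Qx]]|/hone[x' [Sx Qx]]]].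
- by left; apply/hinf; exists x'.
- by right; apply/hone; exists x'.
- by exists x'; split => //; left.
- by exists x'; split => //; right.
Qed.

Lemma radii_ge0 : 0 <= 3 / k /\ 0 <= 3 * k.
Proof. by split; [apply: divr_ge0|apply: mulr_ge0]. Qed.

Lemma attack_belowP t (x : 'rV[R]_n.+2) : 0 <= t ->
  (exists x', (S_inf x `|` S_1 x) x' /\ step_classifier t x' != 1) <->
  attack_below t (x 0 ord0) (tail_sum x).
Proof.
move=> t0; have [r0 K0] := radii_ge0.
have clsE x' : step_classifier t x' != 1 <-> tail_sum x' <= threshold t (x' 0 ord0).
  by rewrite /step_classifier; case: ltP => h; rewrite ?eqxx// lt_eqF//; lra.
rewrite (_ : (exists x', _) <-> exists x', (S_inf x `|` S_1 x) x' /\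
  tail_sum x' <= threshold t (x' 0 ord0)); last first.
  by split=> -[x' [Sx /clsE h]]; exists x'.
rewrite (attack_plane x (fun a b => b <= threshold t a)).
rewrite inf_belowP// one_belowP//; split; first by case=> h; apply/orP; [left|right].
by case/orP; [left|right].
Qed.

Lemma attack_aboveP t (x : 'rV[R]_n.+2) : 0 <= t ->
  (exists x', (S_inf x `|` S_1 x) x' /\ step_classifier t x' != -1) <->
  attack_above t (x 0 ord0) (tail_sum x).
Proof.
move=> t0; have [r0 K0] := radii_ge0.
have clsE x' : step_classifier t x' != -1 <-> threshold t (x' 0 ord0) < tail_sum x'.
  by rewrite /step_classifier; case: ltP => h; rewrite ?eqxx// gt_eqF//; lra.
rewrite (_ : (exists x', _) <-> exists x', (S_inf x `|` S_1 x) x' /\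
  threshold t (x' 0 ord0) < tail_sum x'); last first.
  by split=> -[x' [Sx /clsE h]]; exists x'.
rewrite (attack_plane x (fun a b => threshold t a < b)).
rewrite inf_aboveP// one_aboveP//; split; first by case=> h; apply/orP; [left|right].
by case/orP; [left|right].
Qed.

(** Since [3 / k < 1 / 4], the box attack leaves the threshold at [- t] and needs [s <= 3 * k - t].
    The l1 attack on the opposite region needs [s <= t + 5 / 4], and [14 <= k] gives
    [5 / 4 <= 18 / 200 * k], so both meet the same bound. *)
Lemma attack_below_bound s : 14 <= k -> attack_below (291 / 200 * k) 1 s ->
  s <= 309 / 200 * k.
Proof.
move=> k14; have k0 : 0 < k by lra.
have ik : 3 / k < 1 / 4 by rewrite ltr_pdivrMr//; lra.
case/orP.
  have [h1 h2] : - (3 / 4) < 1 - 3 / k /\ 3 / 4 < 1 - 3 / k by split; lra.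
  by rewrite /inf_below /threshold !(leNgt (1 - _)) h1 h2/=; lra.
by case/or3P => [?|/and3P[? ? ?]|/and3P[? ? ?]]; lra.
Qed.

Lemma attack_above_bound s : 14 <= k -> attack_above (291 / 200 * k) (-1) s ->
  - (309 / 200 * k) <= s.
Proof.
move=> k14; have k0 : 0 < k by lra.
have ik : 3 / k < 1 / 4 by rewrite ltr_pdivrMr//; lra.
case/orP.
  have h : - 1 + 3 / k <= - (3 / 4) by lra.
  by rewrite /inf_above /threshold h; lra.
by case/or3P => [?|/and3P[? ? ?]|/and3P[? ? ?]]; lra.
Qed.

Section measurability.
Context {dO : measure_display} {T : measurableType dO}.
Variables (U V : T -> R) (t : R).
Hypotheses (mU : measurable_fun setT U) (mV : measurable_fun setT V).

Lemma measurable_fun_threshold (W : T -> R) : measurable_fun setT W ->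
  measurable_fun setT (fun w => threshold t (W w)).
Proof.
by move=> mW; do 2 (apply: measurable_fun_ifT => //; first exact: measurable_fun_ler).
Qed.

Let measurable_bool_set (b : T -> bool) :
  measurable_fun setT b -> measurable [set w | b w].
Proof.
by move=> mb; rewrite -[X in measurable X]setTI; exact: (mb measurableT [set true]).
Qed.

Lemma measurable_attack_below : measurable [set w | attack_below t (U w) (V w)].
Proof.
apply: measurable_bool_set; rewrite /attack_below /inf_below /one_below.
do ![apply: measurable_or | apply: measurable_and | apply: measurable_fun_ler
  | apply: measurable_fun_ltr | apply: measurable_fun_threshold
  | apply: measurable_funB | apply: measurable_funD] => //.
Qed.

Lemma measurable_attack_above : measurable [set w | attack_above t (U w) (V w)].
Proof.
apply: measurable_bool_set; rewrite /attack_above /inf_above /one_above.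
do ![apply: measurable_or | apply: measurable_and | apply: measurable_fun_ler
  | apply: measurable_fun_ltr | apply: measurable_fun_threshold
  | apply: measurable_funB | apply: measurable_funD] => //.
Qed.
End measurability.
End upper_bound.

(** * Risk of the step classifier under the data law *)

Section upper_bound.
Context {R : realType} {n : nat} {dO : measure_display} {T : measurableType dO}.
Variables (p0 : R) (P : probability T R) (Y : T -> R) (X : T -> 'rV[R]_n.+2).
Hypothesis law : has_law_D 2 p0 P Y X.
Notation k := (Num.sqrt n.+1%:R : R).
Notation S x := (S_inf x `|` S_1 x).

Let k0 : 0 < k. Proof. by rewrite sqrtr_gt0 ltr0n. Qed.

Let n11 : (1 : R) != -1. Proof. by rewrite gt_eqF//; lra. Qed.

(** This form exhibits the event as measurable. The last piece is there because the classifier errs,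
    even unattacked, at any label other than [1] and [-1]. *)
Lemma adv_event_clf (t : R) : 0 <= t ->
  adv_event Y X (step_classifier t) (fun x => S x) =
  (Y @^-1` [set 1] `&` [set w | @attack_below R n t (X w 0 ord0) (tail_sum (X w))]) `|`
  (Y @^-1` [set -1] `&` [set w | @attack_above R n t (X w 0 ord0) (tail_sum (X w))]) `|`
  ~` (Y @^-1` [set 1] `|` Y @^-1` [set -1]).
Proof.
move=> t0; apply/seteqP; split => w.
  move=> [x' [Sx fx]].
  have [Y1|Y1] := eqVneq (Y w) 1.
    left; left; split => //; apply/attack_belowP => //; exists x'; split => //.
    by rewrite -Y1.
  have [Y2|Y2] := eqVneq (Y w) (-1).
    left; right; split => //; apply/attack_aboveP => //; exists x'; split => //.
    by rewrite -Y2.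
  by right=> -[]/= /eqP; [rewrite (negbTE Y1)|rewrite (negbTE Y2)].
case=> [[[/= Y1 /attack_belowP]|[/= Y1 /attack_aboveP]]|/= Y12].
- by move=> /(_ t0)[x' [Sx fx]]; exists x'; rewrite Y1.
- by move=> /(_ t0)[x' [Sx fx]]; exists x'; rewrite Y1.
exists (X w); split.
  right; exists 0; rewrite ?addr0//=.
  by rewrite /l1_norm big1// => i _; rewrite mxE normr0.
apply/eqP => Yw; apply: Y12.
by case: (step_classifier_pm1 t (X w)); rewrite Yw; [left|right].
Qed.

Lemma measurable_tail_sum : measurable_fun setT (fun w => tail_sum (X w)).
Proof. by have [_ mX _] := law; apply: measurable_sum => i; exact: mX. Qed.

Lemma measurable_adv_event_clf (t : R) : 0 <= t ->
  measurable (adv_event Y X (step_classifier t) (fun x => S x)).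
Proof.
move=> t0; have [mY mX _] := law; rewrite adv_event_clf//.
have mYc c : measurable (Y @^-1` [set c]) by rewrite -[X in measurable X]setTI; apply: mY.
apply: measurableU; last by apply: measurableC; apply: measurableU.
apply: measurableU; apply: measurableI => //.
- exact: (measurable_attack_below _ _ _ (mX ord0) measurable_tail_sum).
- exact: (measurable_attack_above _ _ _ (mX ord0) measurable_tail_sum).
Qed.

(** Each of the [n.+1] summands has mean [y * (2 / k)] and variance [1], where [k ^+ 2 = n.+1]; the
    mass of the signed event is the constant of [normal_sum]. *)
Lemma tail_sum_law (y s : R) (A : set R) : y = 1 \/ y = -1 -> s = 1 \/ s = -1 ->
  0 <= sign_prob p0 s -> measurable A ->
  (P (signed_event Y X y s `&` [set w | A (tail_sum (X w))]) =
   (sign_prob p0 s)%:E * normal_prob (y * (2 * k))%R k A)%E.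
Proof.
move=> y1 s1 ps mA; have [mY mX _] := law.
have mS := measurable_signed_event _ _ _ _ _ law y s.
have sumE := @normal_sum _ _ _ P n _ (fun i w => X w 0 (lift ord0 i))
  (sign_prob p0 s) (fun=> y * (2 / k)) (fun=> 1) mS (fun i => mX (lift ord0 i))
  ps (fun=> ltr01) (fun B mB => signed_event_law _ _ _ _ _ law y s B y1 s1 mB) A mA.
rewrite !sumr_const !card_ord expr1n in sumE.
have <- : (y * (2 / k)) *+ n.+1 = y * (2 * k).
  rewrite -[LHS]mulr_natr -[X in _ * X = _](@sqr_sqrtr R n.+1%:R)//.
  by field; rewrite gt_eqF.
exact: sumE.
Qed.

Lemma adv_event_clf_prob : 139 / 144 <= p0 <= 1 -> 14 <= k ->
  (P (adv_event Y X (step_classifier (291 / 200 * k)) (fun x => S x)) <=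
   (35%:R / 100%:R)%:E)%E.
Proof.
move=> /andP[p0_ge p0_le] k14; have [mY mX _] := law.
have t0 : 0 <= 291 / 200 * k by lra.
(* The tail bound at [91 / 200 = 2 - 309 / 200] standard deviations from the mean. *)
pose q : R := 2^-1 - 32 / 81 * (91 / 200 - (91 / 200) ^+ 3 / 6).
pose E1 := signed_event Y X 1 1 `&`
  [set w | `]-oo, 309 / 200 * k]%classic (tail_sum (X w))].
pose E2 := signed_event Y X (-1) 1 `&`
  [set w | `[- (309 / 200 * k), +oo[%classic (tail_sum (X w))].
pose F1 := signed_event Y X 1 (-1).
pose F2 := signed_event Y X (-1) (-1).
pose G := (signed_event Y X 1 1 `|` signed_event Y X (-1) 1) `|` (F1 `|` F2).
have mS y s : measurable (signed_event Y X y s) :=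
  measurable_signed_event _ _ _ _ _ law y s.
have msum (A : set R) : measurable A -> measurable [set w | A (tail_sum (X w))].
  by move=> mA; rewrite -[X in measurable X]setTI; exact: measurable_tail_sum.
have mE1 : measurable E1 by apply: measurableI => //; apply: msum; exact: measurable_itv.
have mE2 : measurable E2 by apply: measurableI => //; apply: msum; exact: measurable_itv.
have sp1 : sign_prob p0 1 = 2^-1 * p0 by rewrite /sign_prob eqxx.
have sp2 : sign_prob p0 (-1) = 2^-1 * (1 - p0).
  by rewrite /sign_prob ifF// eq_sym (negbTE n11).
have PS1 y : y = 1 \/ y = -1 -> P (signed_event Y X y 1) = (2^-1 * p0)%:E.
  by move=> y1; rewrite -sp1; apply: (signed_event_prob _ _ _ _ _ law) => //; left.
have PS2 y : y = 1 \/ y = -1 -> P (signed_event Y X y (-1)) = (2^-1 * (1 - p0))%:E.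
  by move=> y1; rewrite -sp2; apply: (signed_event_prob _ _ _ _ _ law) => //; right.
have PE1 : (P E1 <= (2^-1 * p0 * q)%:E)%E.
  rewrite tail_sum_law//; [|by left|by left|by rewrite sp1; lra].
  rewrite sp1 [leRHS]EFinM lee_wpmul2l//; first by rewrite lee_fin; lra.
  have := normal_prob_lower_tail (1 * (2 * k)) k (91 / 200) k0 ltac:(lra).
  by rewrite (_ : 1 * (2 * k) - 91 / 200 * k = 309 / 200 * k)//; lra.
have PE2 : (P E2 <= (2^-1 * p0 * q)%:E)%E.
  rewrite tail_sum_law//; [|by right|by left|by rewrite sp1; lra].
  rewrite sp1 [leRHS]EFinM lee_wpmul2l//; first by rewrite lee_fin; lra.
  have := normal_prob_upper_tail (-1 * (2 * k)) k (91 / 200) k0 ltac:(lra).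
  by rewrite (_ : -1 * (2 * k) + 91 / 200 * k = - (309 / 200 * k))//; lra.
have dis y s y' s' : y = 1 \/ y = -1 -> (y, s) != (y', s') ->
    signed_event Y X y s `&` signed_event Y X y' s' = set0.
  move=> y1 ne; have [yy|yy] := eqVneq y y'.
    rewrite -yy; apply: signed_event_disj => //.
    by apply: contra_neq ne => ->; rewrite yy.
  by rewrite -subset0 => w [[+ _] [+ _]] => ->; apply/eqP.
(* The law only gives masses of rectangles; the four disjoint signed events already sum to one, so
   no other values of the label and first coordinate carry mass. *)
have PG : P G = 1%E.
  have mA y : measurable (signed_event Y X 1 y `|` signed_event Y X (-1) y).
    exact: measurableU.
  have PU s : P (signed_event Y X 1 s `|` signed_event Y X (-1) s) =
      (P (signed_event Y X 1 s) + P (signed_event Y X (-1) s))%E.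
    by apply: measureU => //; apply: dis; [left|rewrite xpair_eqE (negbTE n11)].
  transitivity (P (signed_event Y X 1 1 `|` signed_event Y X (-1) 1) + P (F1 `|` F2))%E.
    apply: measureU; [exact: mA|exact: mA|].
    by rewrite !setIUl !setIUr !dis ?setU0//; (try by [left|right]);
      rewrite xpair_eqE ?(eq_sym (-1)) (negbTE n11) ?andbF.
  rewrite !PU !PS1 ?PS2; try by [left|right].
  by rewrite -!EFinD; congr EFin; lra.
have mF : measurable (F1 `|` F2) by apply: measurableU; exact: mS.
have mG : measurable G by apply: measurableU => //; apply: measurableU; exact: mS.
(* On [G], a successful attack puts the tail sum in the tail of [E1] or [E2] when the first
   coordinate agrees with the label; [F1] and [F2] are counted in full. *)
have EG : adv_event Y X (step_classifier (291 / 200 * k)) (fun x => S x) `<=`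
    (E1 `|` E2) `|` (F1 `|` F2) `|` ~` G.
  rewrite adv_event_clf// => w Ew.
  have [Gw|] := pselect (G w); last by right.
  left; case: Gw => [[Gw|Gw]|]; [left; left|left; right|by right].
    split => //=; case: Gw => Y1; rewrite mul1r => X1.
    rewrite in_itv/=; apply: attack_below_bound => //.
    case: Ew => [[[_]|[+ _]]|]; first by rewrite /= X1.
      by rewrite /= Y1 => /eqP; rewrite (negbTE n11).
    by case; left.
  split => //=; case: Gw => Y1; rewrite mul1r => X1.
  rewrite in_itv/= andbT; apply: attack_above_bound => //.
  case: Ew => [[[+ _]|[_]]|]; last 1 first.
  - by case; right.
  - by rewrite /= Y1 => /esym/eqP; rewrite (negbTE n11).
  - by rewrite /= X1.
have PG0 : P (~` G) = 0%E by rewrite probability_setC// PG subee.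
have mE : measurable (E1 `|` E2) by exact: measurableU.
apply: (@le_trans _ _ (P ((E1 `|` E2) `|` (F1 `|` F2) `|` ~` G))).
  apply: le_measure; rewrite ?inE//; first exact: measurable_adv_event_clf.
  by do !apply: measurableU => //; exact: measurableC.
rewrite measureU0//; [|by do !apply: measurableU => //|exact: measurableC].
apply: (le_trans (measureU2 P mE mF)).
apply: (@le_trans _ _ ((2^-1 * p0 * q)%:E + (2^-1 * p0 * q)%:E +
  ((2^-1 * (1 - p0))%:E + (2^-1 * (1 - p0))%:E)))%E.
  apply: leeD.
    by apply: (le_trans (measureU2 P mE1 mE2)); exact: leeD.
  apply: (le_trans (measureU2 P (mS _ _) (mS _ _))).
  by rewrite -[leRHS](congr2 adde (PS2 1 (or_introl erefl)) (PS2 (-1) (or_intror erefl))).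
rewrite -!EFinD lee_fin.
(* The bound [p0 * q + (1 - p0)] decreases in [p0], and at [p0 = 139 / 144] it is just below
   [0.35]. *)
have q1 : q <= 3265 / 10000 by rewrite /q; lra.
nra.
Qed.

End upper_bound.

Theorem mainTheorem6 (R : realType) (d : nat) : (200 <= d)%N ->
  let alpha : R := 2 in
  let p0 : R := 1 - Phi (-2) in
  (exists g : 'rV[R]_d.+1 -> R, pm1_classifier g /\
    forall (dO : measure_display) (Omega : measurableType dO)
           (P : probability Omega R) (Y : Omega -> R) (X : Omega -> 'rV[R]_d.+1),
      has_law_D alpha p0 P Y X ->
      measurable (adv_event Y X g (fun x => S_inf x `|` S_1 x)) /\
      (adv_risk P Y X g (fun x => S_inf x `|` S_1 x) <= (35%:R / 100%:R)%:E)%E)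
  /\
  (forall (dO : measure_display) (Omega : measurableType dO)
          (P : probability Omega R) (Y : Omega -> R) (X : Omega -> 'rV[R]_d.+1),
     has_law_D alpha p0 P Y X ->
     forall f : 'rV[R]_d.+1 -> R, pm1_classifier f ->
       ((2^-1)%:E <= adv_risk P Y X f S_affine)%E).
Proof.
move=> d200 alpha p0; split; last first.
  move=> dO Omega P Y X law f f1; apply: adv_risk_S_affine_ge law f1.
  exact: leq_trans d200.
case: d d200 => // n n200.
(* As [196 = 14 ^+ 2], the hypothesis on [d] suffices for the bound used on both attacks. *)
have k14 : 14 <= Num.sqrt n.+1%:R :> R.
  have -> : 14 = Num.sqrt (196%:R) :> R.
    by rewrite (_ : 196%:R = 14%:R ^+ 2) ?sqrtr_sqr ?ger0_norm// -natrX.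
  by rewrite ler_sqrt// ler_nat (leq_trans _ n200).
have Phi01 : 0 <= Phi (-2) :> R by exact: fine_ge0.
have Phi_le := @Phi_N2_le R.
have t0 : 0 <= 291 / 200 * Num.sqrt n.+1%:R :> R by lra.
exists (step_classifier (291 / 200 * Num.sqrt n.+1%:R)); split.
  exact: step_classifier_pm1.
move=> dO Omega P Y X law.
have mE := measurable_adv_event_clf _ _ _ _ law _ t0.
split => //.
apply: (@le_trans _ _ (P (adv_event Y X
  (step_classifier (291 / 200 * Num.sqrt n.+1%:R)) (fun x => S_inf x `|` S_1 x)))).
  (* The measurable event is its own cover, so its outer probability is at most its probability. *)
  by apply: ereal_inf_lbound; eexists; [split; [exact: mE|]|].
by apply: (adv_event_clf_prob _ _ _ _ law) => //; apply/andP; rewrite /p0; split; lra.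
Qed.
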